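(* Consider the adversarial bandit problem with $N$ arms, exactly $K$ plays per round ($1\le K\le N$), a fixed number of rounds $T$, and no costs. Let $\delta\in(0,1)$. Then the regret of Algorithm Exp3.P.M (with the parameters given in the context) satisfies, with probability at least $1-\delta$, $$\mathcal{R}=G_{\max}-G_{\mathrm{Exp3.P.M}}\le 2\sqrt5\sqrt{NKT\log(N/K)}+8\,\frac{N-K}{N-1}\log\left(\frac{NT}{\delta}\right)+2(1+K^2)\sqrt{NT\,\frac{N-K}{N-1}\log\left(\frac{NT}{\delta}\right)}.$$
   Context: Setting. Rewards $r_i(t)\in[0,1]$, $i\in[N]$, $1\le t\le T$, are fixed in advance. In each round $t$ the player chooses $a_t\subseteq[N]$, $|a_t|=K$, and observes $r_i(t)$ for $i\in a_t$. The gain of the algorithm is $\sum_{t=1}^T\sum_{i\in a_t}r_i(t)$, and $G_{\max}=\max_{a\subseteq[N],|a|=K}\sum_{t=1}^T\sum_{i\in a}r_i(t)$. Probability is over the algorithm's internal randomness. Algorithm Exp3.P.M with parameters $\gamma\in[0,1]$ and $\alpha\ge 0$. Start with $w_i(1)=\exp\left(\alpha\gamma K^2\sqrt{T/N}/3\right)$ for all $i\in[N]$. For $t=1,\dots,T$: (1) If $\gamma<1$ and $(1-\gamma)\max_i w_i(t)\ge\left(\frac1K-\frac{\gamma}{N}\right)\sum_{j=1}^N w_j(t)$, choose $v_t>0$ with $$\frac1K-\frac{\gamma}{N}=\frac{v_t(1-\gamma)}{\sum_{i=1}^N\left(v_t\mathbf{1}(w_i(t)\ge v_t)+w_i(t)\mathbf{1}(w_i(t)<v_t)\right)},$$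 let $\tilde S(t)=\{i: w_i(t)\ge v_t\}$ and $\tilde w_i(t)=v_t$ for $i\in\tilde S(t)$; otherwise let $\tilde S(t)=\emptyset$. Set $\tilde w_i(t)=w_i(t)$ for $i\notin\tilde S(t)$. (2) Set $p_i(t)=K\left((1-\gamma)\frac{\tilde w_i(t)}{\sum_j\tilde w_j(t)}+\frac{\gamma}{N}\right)$. (3) Draw a random set $a_t$ with $|a_t|=K$ such that, conditionally on the past, each $i$ belongs to $a_t$ with probability $p_i(t)$. (4) Set $\hat r_i(t)=\frac{r_i(t)}{p_i(t)}\mathbf{1}(i\in a_t)$ and $$w_i(t+1)=w_i(t)\exp\left[\mathbf{1}(i\notin\tilde S(t))\frac{\gamma K}{3N}\left(\hat r_i(t)+\frac{\alpha}{p_i(t)\sqrt{NT}}\right)\right].$$ Parameters: $\alpha=2\sqrt{\frac{N-K}{N-1}\log\left(\frac{NT}{\delta}\right)}$ and $\gamma=\min\left(\frac35,\frac{3}{\sqrt5}\sqrt{\frac{N\log(N/K)}{KT}}\right)$. *)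

(* Defs.v *)
From HB Require Import structures.
From mathcomp Require Import all_boot all_order all_algebra.
From mathcomp Require Import all_classical all_reals all_analysis.

Set Implicit Arguments.
Unset Strict Implicit.
Unset Printing Implicit Defensive.

Import Order.TTheory GRing.Theory Num.Theory.

Local Open Scope classical_set_scope.
Local Open Scope ring_scope.

(* Rounds are numbered from 0 to T - 1. *)

Section Algorithm.
Context {R : realType}.
Variables (N K T : nat) (gamma alpha : R) (r : nat -> 'I_N -> R).

(* A history lists the sets drawn so far, most recent first, so that the index
   of the current round is the size of the history. *)
Definition history := seq {set 'I_N}.

(* The weights are positive, so 0 is a neutral default for the maximum. *)
Definition capping (w : 'I_N -> R) : bool :=
  (gamma < 1) &&
  ((K%:R^-1 - gamma / N%:R) * \sum_j w j
     <= (1 - gamma) * \big[Num.max/0]_i w i).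

Definition cap_spec (w : 'I_N -> R) (v : R) : Prop :=
  0 < v /\
  K%:R^-1 - gamma / N%:R =
    v * (1 - gamma) /
      \sum_i (v * (v <= w i)%R%:R + w i * (w i < v)%R%:R).

Definition capped_set (w : 'I_N -> R) (v : R) : {set 'I_N} :=
  if capping w then [set i | v <= w i]%SET else finset.set0.

Definition capped_weight (w : 'I_N -> R) (v : R) (i : 'I_N) : R :=
  if i \in capped_set w v then v else w i.

Definition draw_proba (w : 'I_N -> R) (v : R) (i : 'I_N) : R :=
  K%:R * ((1 - gamma) * (capped_weight w v i / \sum_j capped_weight w v j)
          + gamma / N%:R).

Definition reward_estimate (t : nat) (w : 'I_N -> R) (v : R) (A : {set 'I_N})
    (i : 'I_N) : R :=
  r t i / draw_proba w v i * (i \in A)%:R.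

Definition init_weight : R :=
  expR (alpha * gamma * K%:R ^+ 2 * Num.sqrt (T%:R / N%:R) / 3).

Definition next_weight (t : nat) (w : 'I_N -> R) (v : R) (A : {set 'I_N})
    (i : 'I_N) : R :=
  w i * expR ((i \notin capped_set w v)%:R * (gamma * K%:R / (3 * N%:R)) *
              (reward_estimate t w v A i +
               alpha / (draw_proba w v i * Num.sqrt (N%:R * T%:R)))).

(* [v h] is the cap chosen after history [h]; it is only used when capping
   occurs. *)
Fixpoint weight (v : history -> R) (h : history) : 'I_N -> R :=
  if h is A :: h' then next_weight (size h') (weight v h') (v h') A
  else fun=> init_weight.

Definition history_proba (v : history -> R) (h : history) : 'I_N -> R :=
  draw_proba (weight v h) (v h).

End Algorithm.

Fixpoint past {Omega : Type} {N : nat} (a : nat -> Omega -> {set 'I_N}) (t : nat)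
    (omega : Omega) : history N :=
  if t is s.+1 then a s omega :: past a s omega else [::].

(* [a t] is the set drawn in round [t] and [v] is any rule choosing the caps.
   The joint law of the draws is constrained only through [run_marginal]:
   P(i \in a_t | past) = p_i(t), where the past is the finite-valued vector of
   the previous draws, so that conditioning is elementary and is written in
   product form to cover histories of probability 0. *)
Record exp3pm_run {R : realType} (N K T : nat) (gamma alpha : R)
    (r : nat -> 'I_N -> R) (d : measure_display) (Omega : measurableType d)
    (P : probability Omega R) (a : nat -> Omega -> {set 'I_N})
    (v : history N -> R) : Prop := Exp3pmRun {
  run_measurable : forall (t : nat) (A : {set 'I_N}), (t < T)%N ->
    measurable [set omega | a t omega = A];
  run_card : forall (t : nat) (omega : Omega), (t < T)%N ->
    #|a t omega| = K;
  run_cap : forall (t : nat) (omega : Omega), (t < T)%N ->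
    let h := past a t omega in
    let w := weight K T gamma alpha r v h in
    capping K gamma w -> cap_spec K gamma w (v h);
  run_marginal : forall (t : nat) (h : history N) (i : 'I_N), (t < T)%N ->
    P ([set omega | past a t omega = h] `&` [set omega | i \in a t omega]) =
    ((history_proba K T gamma alpha r v h i)%:E *
      P [set omega | past a t omega = h])%E
}.

Section Regret.
Context {R : realType}.
Variables (N K T : nat) (r : nat -> 'I_N -> R).

(* Rewards are nonnegative, so 0 is a neutral default for the maximum. *)
Definition best_gain : R :=
  \big[Num.max/0]_(A : {set 'I_N} | #|A| == K)
    \sum_(t < T) \sum_(i in A) r t i.

Definition gain {Omega : Type} (a : nat -> Omega -> {set 'I_N}) (omega : Omega)
    : R :=
  \sum_(t < T) \sum_(i in a t omega) r t i.

Definition regret {Omega : Type} (a : nat -> Omega -> {set 'I_N})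
    (omega : Omega) : R :=
  best_gain - gain a omega.

End Regret.

Section Tuning.
Context {R : realType}.
Variables (N K T : nat) (delta : R).

(* For N = 1 (hence K = 1) the quotient 0 / 0 is read as 0. *)
Definition log_term : R :=
  (N%:R - K%:R) / (N%:R - 1) * ln (N%:R * T%:R / delta).

Definition alpha_param : R := 2 * Num.sqrt log_term.

Definition gamma_param : R :=
  Num.min (3 / 5)
    (3 / Num.sqrt 5 *
     Num.sqrt (N%:R * ln (N%:R / K%:R) / (K%:R * T%:R))).

End Tuning.

(* Main.v *)
Require Import Defs.
From HB Require Import structures.
From mathcomp Require Import all_boot all_order all_algebra.
From mathcomp Require Import all_classical all_reals all_analysis.
From mathcomp Require Import ring lra.

Set Implicit Arguments.
Unset Strict Implicit.
Unset Printing Implicit Defensive.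

Import Order.TTheory GRing.Theory Num.Theory.

Local Open Scope classical_set_scope.
Local Open Scope ring_scope.

(** In the rounds where arm [i] is not capped, [exp (s sum (r - rhat - s / p))] is
    a supermartingale for [s = alpha / sqrt (N T)], since [E rhat = r] and
    [E (r - rhat)^2 <= 1 / p]; a fixed [s <= 1 / 2] suffices.  In the rounds where
    [i] is capped it is drawn almost surely.  Markov's inequality and a union
    bound over the arms then give, with probability at least [1 - delta], that the
    total reward of every arm is at most its upper confidence estimate
    [sum (rhat + s / p)] plus [ln (N / delta) / s <= alpha K sqrt (N T)].
    On that event, bounding the growth of the sum of the weights by
    [exp y <= 1 + y + y^2], and its final value from below by Jensen's inequality,
    controls the estimates of the best [K] arms by the gain of the algorithm.
    When [gamma = 3 / 5], or [s > 1 / 2], or [K = N], the regret bound holds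
    trivially. *)

(** * Elementary inequalities for the exponential *)

(** With [z = y / 4], the tangent bound [1 - z <= expR (- z)] raised to the fourth power leaves a
    polynomial inequality, in which [z <= 1 / 8] keeps [6 - 44 * z] positive. Very negative [y] must
    be covered: [s * (x - x / p)] is not bounded from below uniformly in [p]. *)
Lemma expR_le_quadratic {R : realType} (y : R) :
  y <= 1 / 2 -> expR y <= 1 + y + y ^+ 2.
Proof.
move=> y_le; set z := y / 4.
have yE : y = 4 * z by rewrite /z; lra.
have z_le : z <= 1 / 8 by rewrite /z; lra.
have inv_ge : (1 - z) ^+ 4 <= expR (- y).
  have -> : - y = 4%:R * - z by rewrite yE; ring.
  rewrite expRM_natl lerXn2r ?nnegrE ?expR_ge0 //.
    lra.
  by have := expR_ge1Dx (- z).
have quad_ge0 : 0 <= 1 + y + y ^+ 2 by nra.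
have quad_ge1 : 1 <= (1 + y + y ^+ 2) * (1 - z) ^+ 4.
  have -> : (1 + y + y ^+ 2) * (1 - z) ^+ 4 = 1 +
    z ^+ 2 * (6 - 44 * z + z ^+ 2 * (81 - 60 * z) + 16 * z ^+ 4).
    by rewrite yE; ring.
  have z2_ge0 := sqr_ge0 z; have z4_ge0 : 0 <= z ^+ 4 by rewrite exprn_even_ge0.
  have z3_ge0 : 0 <= z ^+ 2 * (81 - 60 * z) by rewrite mulr_ge0 //; lra.
  by rewrite lerDl mulr_ge0 //; lra.
rewrite -[leLHS]mul1r -[y in expR y]opprK expRN ler_pdivrMr ?expR_gt0 //.
exact: le_trans quad_ge1 (ler_wpM2l quad_ge0 inv_ge).
Qed.

(** For a bit [b] of mean [p], [x - x / p * b] is centred with second moment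
    [x ^+ 2 * (1 / p - 1) <= 1 / p]. The quadratic bound gives at most [1 + s ^+ 2 / p], which the
    factor [expR (- (s ^+ 2 / p))] absorbs. *)
Lemma importance_weighted_mgf_le1 {R : realType} (p x s : R) :
  0 < p -> p <= 1 -> 0 <= x <= 1 -> 0 <= s <= 1 / 2 ->
  p * expR (s * (x - x / p - s / p)) + (1 - p) * expR (s * (x - s / p)) <= 1.
Proof.
move=> p_gt0 p_le1 x01 s_bd.
have pV : p * p^-1 = 1 by rewrite divff ?gt_eqF.
have q_ge1 : 1 <= p^-1 by rewrite invf_ge1.
set q := p^-1 in pV q_ge1 *.
have -> : s * (x - x * q - s * q) = s * (x - x * q) + - (s ^+ 2 * q) by ring.
have -> : s * (x - s * q) = s * x + - (s ^+ 2 * q) by ring.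
rewrite !expRD !mulrA -mulrDl expRN ler_pdivrMr ?expR_gt0 // mul1r.
have le1 : expR (s * (x - x * q)) <=
    1 + s * (x - x * q) + (s * (x - x * q)) ^+ 2.
  apply: expR_le_quadratic; have : 0 <= s * (x * (q - 1)).
    by rewrite !mulr_ge0 //; lra.
  by lra.
have le2 : expR (s * x) <= 1 + s * x + (s * x) ^+ 2.
  by apply: expR_le_quadratic; nra.
apply: le_trans (expR_ge1Dx _).
have -> : 1 + s ^+ 2 * q = p * (1 + s * (x - x * q) + (s * (x - x * q)) ^+ 2)
    + (1 - p) * (1 + s * x + (s * x) ^+ 2)
    + (s ^+ 2 * q - s ^+ 2 * x ^+ 2 * (q - 1)).
  have -> : p * (1 + s * (x - x * q) + (s * (x - x * q)) ^+ 2) =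
     p + s * x * (p - p * q) + s ^+ 2 * x ^+ 2 * (p - 2 * (p * q) + (p * q) * q)
    by ring.
  by rewrite pV; ring.
apply: ler_wpDr; last by apply: lerD; apply: ler_wpM2l => //; lra.
rewrite -mulrA -mulrBr mulr_ge0 ?sqr_ge0 // subr_ge0.
have : x ^+ 2 <= 1 by rewrite expr_le1 //; lra.
have := sqr_ge0 x; nra.
Qed.

(** Jensen's inequality: the exponential lies above its tangent at the mean [mu], and the deviations
    from [mu] sum to zero. *)
Lemma card_mul_expR_mean_le {R : realType} (I : finType) (A : {set I})
    (f : I -> R) : (0 < #|A|)%N ->
  #|A|%:R * expR (#|A|%:R^-1 * \sum_(i in A) f i) <= \sum_(i in A) expR (f i).
Proof.
move=> A_gt0; set m := #|A|%:R; set mu := m^-1 * _.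
have m_neq0 : m != 0 by rewrite pnatr_eq0 -lt0n.
have -> : m * expR mu = \sum_(i in A) expR mu * (1 + (f i - mu)).
  have muE : mu *+ #|A| = \sum_(i in A) f i by rewrite -mulr_natl mulVKf.
  by rewrite -mulr_sumr big_split/= sumrB !sumr_const muE subrr addr0 mulrC.
apply: ler_sum => i _; rewrite -[f i in leRHS](subrKC mu) expRD.
by rewrite ler_pM2l ?expR_gt0// expR_ge1Dx.
Qed.

(** Applied with [c = K (1 - gamma)]. The comparison of [w i] with [p i] is asked only where
    [y i != 0], because it can fail for a capped arm, whose weight stays fixed in that round. *)
Lemma potential_step {R : realType} (I : finType) (w p y : I -> R) (c : R) :
  0 < c -> (forall i, 0 <= w i) -> (forall i, y i <= 1 / 2) ->
  (forall i, 0 <= y i) ->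
  (forall i, y i != 0 -> c * w i <= p i * \sum_j w j) ->
  \sum_i w i * expR (y i) <=
    (\sum_i w i) * expR (c^-1 * \sum_i p i * (y i + y i ^+ 2)).
Proof.
move=> c_gt0 w_ge0 y_le y_ge0 wp; set W := \sum_i w i.
have W_ge0 : 0 <= W by exact: sumr_ge0.
apply: le_trans (ler_wpM2l W_ge0 (expR_ge1Dx _)).
rewrite mulrDr mulr1 !mulr_sumr -big_split /=; apply: ler_sum => i _.
apply: le_trans (ler_wpM2l (w_ge0 i) (expR_le_quadratic (y_le i))) _.
rewrite -addrA mulrDr mulr1 lerD2l.
have [->|/wp {}wp] := eqVneq (y i) 0.
  by rewrite expr0n addr0 !mulr0.
rewrite [leRHS](_ : _ = c^-1 * (p i * W) * (y i + y i ^+ 2)); last by ring.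
apply: ler_wpM2r; first by rewrite addr_ge0 ?sqr_ge0.
by rewrite ler_pdivlMl.
Qed.

(** The second-order term is [eta * (eta / p)] times [(x b + s) ^+ 2 <= 2 x b + 2 s ^+ 2]. The part
    [2 x b] keeps its factor [1 / p] and becomes a multiple of the reward estimate; the part
    [2 s ^+ 2] uses [eta / p <= 1 / 3]. *)
Lemma score_moments {R : realType} (p x s eta : R) (b : bool) :
  0 < p -> eta / p <= 1 / 3 -> 0 <= eta -> 0 <= x <= 1 -> 0 <= s ->
  p * (eta * (x / p * b%:R + s / p) + (eta * (x / p * b%:R + s / p)) ^+ 2) <=
    eta * (x * b%:R + s + 2 * eta * (x / p * b%:R) + 2 / 3 * s ^+ 2).
Proof.
move=> p_gt0 eta_p eta_ge0 /andP[x_ge0 x_le1] s_ge0.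
have q_gt0 : 0 < p^-1 by rewrite invr_gt0.
have pq : p * p^-1 = 1 by rewrite divff ?gt_eqF.
have bb : b%:R * b%:R = b%:R :> R by case: (b); rewrite ?mulr1 ?mulr0.
have b_ge0 : 0 <= b%:R :> R by [].
set c := b%:R in bb b_ge0 *; set q := p^-1 in q_gt0 pq eta_p *.
have sq : (x * c + s) ^+ 2 <= 2 * (x * c) + 2 * s ^+ 2.
  have : (x * c) ^+ 2 <= x * c.
    by rewrite exprMn [c ^+ 2]expr2 bb ler_wpM2r // expr2 ler_piMr.
  have := sqr_ge0 (x * c - s); nra.
rewrite (_ : p * _ =
    eta * ((p * q) * (x * c + s) + (p * q) * ((eta * q) * (x * c + s) ^+ 2))); last by ring.
rewrite pq !mul1r; apply: ler_wpM2l => //.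
have etaq_ge0 : 0 <= eta * q by rewrite mulr_ge0 // ltW.
have := ler_wpM2l etaq_ge0 sq.
have := ler_wpM2r (sqr_ge0 s) eta_p.
nra.
Qed.

(** * Growth of the sum of the weights along a fixed sequence of draws *)

Section Potential.
Context {R : realType}.
Variables (N K T : nat) (gamma s w0 : R).
Variables (x p w : nat -> 'I_N -> R) (S A : nat -> {set 'I_N}).
Hypotheses (K_gt0 : (0 < K)%N) (K_le : (K <= N)%N).
Hypotheses (gamma_gt0 : 0 < gamma) (gamma_lt1 : gamma < 1).
Hypotheses (s_ge0 : 0 <= s) (s_le : s <= 1 / 2) (w0_gt0 : 0 < w0).
Hypothesis x01 : forall t i, (t < T)%N -> 0 <= x t i <= 1.
Hypothesis p_ge : forall t i, (t < T)%N -> K%:R * gamma / N%:R <= p t i.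

(** A third of the exploration floor [K gamma / N] of the draw probabilities, so that
    [eta / p <= 1 / 3] and exponents stay below [(1 + s) / 3 <= 1 / 2]. *)
Let eta : R := gamma * K%:R / (3 * N%:R).

Let score t i : R :=
  (i \notin S t)%:R * (x t i / p t i * (i \in A t)%:R + s / p t i).

Hypothesis w_init : forall i, w 0%N i = w0.
Hypothesis w_next : forall t i, (t < T)%N ->
  w t.+1 i = w t i * expR (eta * score t i).
Hypothesis w_le : forall t i, (t < T)%N -> i \notin S t ->
  K%:R * (1 - gamma) * w t i <= p t i * \sum_j w t j.
Hypothesis S_sub : forall t, (t < T)%N -> S t \subset A t.

(* Upper confidence estimate of the total reward of arm [i]; in the rounds where
   [i] is capped it is drawn with probability 1, so its reward is exact. *)
Let ucb i : R := \sum_(t < T) ((i \in S t)%:R * x t i + score t i).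

Let n_gt0 : 0 < N%:R :> R.
Proof. by rewrite ltr0n (leq_trans K_gt0). Qed.

Let k_gt0 : 0 < K%:R :> R.
Proof. by rewrite ltr0n. Qed.

Let eta_gt0 : 0 < eta.
Proof. by rewrite divr_gt0 ?mulr_gt0. Qed.

Let p_gt0 t i : (t < T)%N -> 0 < p t i.
Proof. by move=> tT; rewrite (lt_le_trans _ (p_ge i tT)) ?divr_gt0 ?mulr_gt0. Qed.

Let eta_p t i : (t < T)%N -> eta / p t i <= 1 / 3.
Proof.
move=> tT; rewrite ler_pdivrMr ?p_gt0 //.
have := p_ge i tT; rewrite (_ : K%:R * gamma / N%:R = 3 * eta); first by lra.
by rewrite /eta; field; rewrite gt_eqF.
Qed.

Let w_gt0 t i : (t <= T)%N -> 0 < w t i.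
Proof.
elim: t => [|t IH] tT; first by rewrite w_init.
by rewrite w_next // mulr_gt0 ?expR_gt0 // IH // ltnW.
Qed.

Let score_ge0 t i : (t < T)%N -> 0 <= score t i.
Proof.
move=> tT; have /andP[x_ge0 _] := x01 i tT; have p0 := ltW (p_gt0 i tT).
by rewrite mulr_ge0 // addr_ge0 ?divr_ge0 // mulr_ge0 ?divr_ge0.
Qed.

Let eta_score_le t i : (t < T)%N -> eta * score t i <= 1 / 2.
Proof.
move=> tT; have /andP[x_ge0 x_le1] := x01 i tT.
have ep := eta_p i tT; have p0 := p_gt0 i tT.
have ep_ge0 : 0 <= eta / p t i by rewrite divr_ge0 // ltW.
have : eta * (x t i / p t i + s / p t i) <= 1 / 2.
  rewrite (_ : eta * _ = eta / p t i * (x t i + s)); last by ring.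
  have : eta / p t i * (x t i + s) <= (1 / 3) * (x t i + s).
    by apply: ler_wpM2r => //; exact: addr_ge0.
  by have := s_le; lra.
apply: le_trans; rewrite ler_pM2l // /score.
have xp : 0 <= x t i / p t i by rewrite divr_ge0 // ltW.
have sp : 0 <= s / p t i by rewrite divr_ge0 // ltW.
by case: (i \notin S t); case: (i \in A t) => /=; lra.
Qed.

(** Bounds the growth of the logarithm of the sum of the weights in round [t], in units of
    [eta / (K (1 - gamma))]. Capped arms have score 0, so only draws outside [S t] count. *)
Let round_bound t : R :=
  \sum_(i in A t :\: S t) x t i + N%:R * s + 2 / 3 * N%:R * s ^+ 2
  + 2 * eta * \sum_i score t i.

Let sum_w_next t : (t < T)%N ->
  \sum_i w t.+1 i <=
  (\sum_i w t i) * expR (eta / (K%:R * (1 - gamma)) * round_bound t).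
Proof.
move=> tT; under eq_bigr do rewrite w_next //.
have c_gt0 : 0 < K%:R * (1 - gamma) by rewrite mulr_gt0 // subr_gt0.
apply: le_trans (potential_step (p := p t) c_gt0 _ _ _ _) _.
- by move=> i; rewrite ltW // w_gt0 // ltnW.
- by move=> i; exact: eta_score_le.
- by move=> i; rewrite mulr_ge0 ?score_ge0 // ltW.
- move=> i; rewrite mulf_eq0 negb_or => /andP[_ si]; apply: w_le => //.
  by apply: contra si => iS; rewrite /score iS /= mul0r.
apply: ler_wpM2l; first by apply: sumr_ge0 => i _; rewrite ltW // w_gt0 // ltnW.
rewrite ler_expR [eta / _]mulrC -mulrA; apply: ler_wpM2l.
  by rewrite invr_ge0 ltW.
have -> : round_bound t = \sum_i ((i \in A t :\: S t)%:R * x t i + s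
    + 2 / 3 * s ^+ 2 + 2 * eta * score t i).
  rewrite /round_bound !big_split /= -!mulr_sumr !sumr_const card_ord.
  rewrite -!(mulr_natl s) [\sum_(i in _) _]big_mkcond /=.
  congr (_ + _ + _ + _); last by ring.
  by apply: eq_bigr => i _; case: ifP; rewrite ?mul1r ?mul0r.
rewrite mulr_sumr; apply: ler_sum => i _; have /andP[x_ge0 x_le1] := x01 i tT.
rewrite inE /score; case: (i \in S t) => /=.
  rewrite !mul0r !mulr0 expr0n /= !addr0 mulr0 add0r.
  by rewrite mulr_ge0 ?addr_ge0 ?mulr_ge0 ?sqr_ge0 // ltW.
rewrite !mul1r; apply: le_trans (score_moments _ _ _ _ _ _) _ => //.
- exact: p_gt0.
- exact: eta_p.
- exact: ltW.
- exact: x01.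
apply: ler_wpM2l; first exact: ltW.
have : 0 <= 2 * eta * (s / p t i).
  have e_ge0 := ltW eta_gt0; have p_ge0 := ltW (p_gt0 i tT).
  by apply: mulr_ge0; [exact: mulr_ge0 | exact: divr_ge0].
by rewrite [x t i * _]mulrC; lra.
Qed.

Let w_final i : w T i = w0 * expR (eta * \sum_(t < T) score t i).
Proof.
suff wE n : (n <= T)%N -> w n i = w0 * expR (eta * \sum_(t < n) score t i).
  exact: wE.
elim: n => [|n IH] nT; first by rewrite w_init big_ord0 mulr0 expR0 mulr1.
by rewrite w_next // IH ?(ltnW nT) // big_ord_recr /= mulrDr expRD mulrA.
Qed.

Let sum_w_final : \sum_i w T i <=
  N%:R * w0 * expR (eta / (K%:R * (1 - gamma)) * \sum_(t < T) round_bound t).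
Proof.
suff wE n : (n <= T)%N -> \sum_i w n i <=
    N%:R * w0 * expR (eta / (K%:R * (1 - gamma)) * \sum_(t < n) round_bound t).
  exact: wE.
elim: n => [|n IH] nT.
  under eq_bigr do rewrite w_init.
  by rewrite sumr_const card_ord big_ord0 mulr0 expR0 mulr1 mulr_natl.
apply: le_trans (sum_w_next nT) _.
rewrite big_ord_recr /= [_ * (_ + round_bound n)]mulrDr expRD [leRHS]mulrA; apply: ler_wpM2r.
  exact: expR_ge0.
by apply: IH; exact: ltnW.
Qed.

Let total_gain : R := \sum_(t < T) \sum_(i in A t) x t i.

Let slack : R := 3 * N%:R / gamma * ln (N%:R / K%:R) + total_gain
  + T%:R * N%:R * s + 2 / 3 * (T%:R * N%:R) * s ^+ 2.

(** The final sum of the weights is bounded below by Jensen's inequality over [B] and above by the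
    accumulated growth. Taking logarithms costs [ln (N / #|B|) <= ln (N / K)], and
    [K / eta = 3 N / gamma]. *)
Let sum_score_le (B : {set 'I_N}) : (K <= #|B|)%N ->
  (1 - gamma) * (K%:R / #|B|%:R * \sum_(i in B) \sum_(t < T) score t i) <=
  3 * N%:R / gamma * ln (N%:R / K%:R) + \sum_(t < T) round_bound t.
Proof.
move=> KB; have B_gt0 : (0 < #|B|)%N := leq_trans K_gt0 KB.
have m_gt0 : 0 < #|B|%:R :> R by rewrite ltr0n.
have g_gt0 : 0 < 1 - gamma by rewrite subr_gt0.
set D := \sum_(i in B) _; set U := \sum_(t < T) round_bound t.
have lnNK_ge0 : 0 <= ln (N%:R / K%:R) :> R.
  by rewrite ln_ge0 // ler_pdivlMr // mul1r ler_nat.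
have : #|B|%:R * expR (#|B|%:R^-1 * (eta * D)) <=
    N%:R * expR (eta / (K%:R * (1 - gamma)) * U).
  rewrite -(ler_pM2l w0_gt0) [leRHS]mulrA [w0 * N%:R]mulrC.
  apply: le_trans sum_w_final; apply: le_trans (_ : \sum_(i in B) w T i <= _).
    rewrite /D mulr_sumr.
    apply: le_trans (ler_wpM2l (ltW w0_gt0) (card_mul_expR_mean_le _ B_gt0)) _.
    by rewrite mulr_sumr; under [leRHS]eq_bigr do rewrite w_final.
  rewrite [leRHS](bigID (mem B)) /= lerDl.
  by apply: sumr_ge0 => i _; rewrite ltW // w_gt0.
rewrite -ler_pdivlMl // [leRHS]mulrA -ler_pdivrMr ?expR_gt0 // -expRB => le_exp.
have : #|B|%:R^-1 * (eta * D) - eta / (K%:R * (1 - gamma)) * U <=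
    ln (N%:R / K%:R).
  rewrite -ler_expR lnK ?posrE ?divr_gt0 //; apply: le_trans le_exp _.
  by rewrite mulrC ler_pM2l // lef_pV2 ?posrE // ler_nat.
have c_gt0 : 0 < K%:R * (1 - gamma) / eta by rewrite divr_gt0 // mulr_gt0.
rewrite -(ler_pM2l c_gt0) mulrBr.
have -> : K%:R * (1 - gamma) / eta * (#|B|%:R^-1 * (eta * D)) =
    (1 - gamma) * (K%:R / #|B|%:R * D).
  by field; rewrite !gt_eqF.
have -> : K%:R * (1 - gamma) / eta * (eta / (K%:R * (1 - gamma)) * U) = U.
  by field; rewrite !gt_eqF.
have -> : K%:R * (1 - gamma) / eta * ln (N%:R / K%:R) =
    (1 - gamma) * (3 * N%:R / gamma * ln (N%:R / K%:R)).
  by rewrite /eta; field; rewrite !gt_eqF.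
have : 0 <= gamma * (3 * N%:R / gamma * ln (N%:R / K%:R)).
  by rewrite !mulr_ge0 // ?invr_ge0 ltW.
by lra.
Qed.

(** Adds the exact rewards of the capped rounds to both sides. On the left their factor
    [(1 - gamma) K / #|B|] is at most 1; on the right they complete the sum over [A t :\: S t] to
    the total gain, as capped arms are drawn. *)
Let mean_ucb_le (B : {set 'I_N}) : (K <= #|B|)%N ->
  (1 - gamma) * (K%:R / #|B|%:R * \sum_(i in B) ucb i) <=
  slack + 2 * eta * \sum_i ucb i.
Proof.
move=> KB; have B_gt0 : (0 < #|B|)%N := leq_trans K_gt0 KB.
have m_gt0 : 0 < #|B|%:R :> R by rewrite ltr0n.
pose capped i : R := \sum_(t < T) (i \in S t)%:R * x t i.
have capped_ge0 i : 0 <= capped i.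
  apply: sumr_ge0 => t _; rewrite mulr_ge0 //.
  by have /andP[] := x01 i (ltn_ord t).
have ucbE (P : pred 'I_N) : \sum_(i | P i) ucb i =
    \sum_(i | P i) capped i + \sum_(i | P i) \sum_(t < T) score t i.
  by rewrite -big_split /=; apply: eq_bigr => i _; rewrite /ucb big_split.
have cappedE : \sum_i capped i = \sum_(t < T) \sum_(i in S t) x t i.
  rewrite exchange_big; apply: eq_bigr => t _ /=; rewrite [RHS]big_mkcond.
  by apply: eq_bigr => i _; case: ifP; rewrite ?mul1r ?mul0r.
have gainE : total_gain =
    \sum_i capped i + \sum_(t < T) \sum_(i in A t :\: S t) x t i.
  rewrite cappedE -big_split; apply: eq_bigr => t _ /=.
  rewrite (big_setID (S t)) /=; congr (_ + _); apply: eq_bigl => i.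
  by rewrite (finset.setIidPr (S_sub (ltn_ord t))).
have := sum_score_le KB; rewrite {1}ucbE mulrDr mulrDr.
have : (1 - gamma) * (K%:R / #|B|%:R * \sum_(i in B) capped i) <=
    \sum_i capped i.
  apply: le_trans (_ : \sum_(i in B) capped i <= _); last first.
    by rewrite [leRHS](bigID (mem B)) /= lerDl sumr_ge0.
  rewrite mulrA ler_piMl ?sumr_ge0 //.
  rewrite mulr_ile1 ?divr_ge0 ?subr_ge0 ?(ltW gamma_lt1) //.
    by rewrite lerBlDr lerDl ltW.
  by rewrite ler_pdivrMr // mul1r ler_nat.
have -> : \sum_(t < T) round_bound t =
    \sum_(t < T) \sum_(i in A t :\: S t) x t i + T%:R * N%:R * s
    + 2 / 3 * (T%:R * N%:R) * s ^+ 2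
    + 2 * eta * \sum_i \sum_(t < T) score t i.
  rewrite /round_bound !big_split /= -!mulr_sumr [in RHS]exchange_big /=.
  rewrite !sumr_const card_ord -!(mulr_natl s).
  by congr (_ + _ + _ + _); ring.
have : 0 <= 2 * eta * \sum_i capped i.
  by rewrite !mulr_ge0 ?sumr_ge0 // ltW.
by rewrite ucbE /slack gainE; lra.
Qed.

(* The bound is applied to [B] and to the set of all arms: the latter controls
   the second-order term [2 * eta * \sum_i ucb i] on the right-hand side. *)
Lemma sum_ucb_le (B : {set 'I_N}) : #|B| = K -> gamma < 3 / 5 ->
  (1 - 5 / 3 * gamma) * \sum_(i in B) ucb i <= slack.
Proof.
move=> BK gamma_lt; have := mean_ucb_le (B := B); rewrite BK => /(_ (leqnn K)).
have := mean_ucb_le (B := [set: 'I_N]%SET); rewrite cardsT card_ord => /(_ K_le).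
rewrite [\sum_(i in [set: _]%SET) _](eq_bigl xpredT); last by move=> i; rewrite inE.
set b := \sum_(i in B) _; set M := \sum_i _; rewrite divff ?gt_eqF // mul1r.
have -> : 2 * eta * M = 2 / 3 * gamma * (K%:R / N%:R * M).
  by rewrite /eta; field; rewrite gt_eqF.
set a := K%:R / N%:R * M => leA leB.
have a_le : (1 - 5 / 3 * gamma) * a <= slack by lra.
have g_gt0 := gamma_gt0; have g_lt1 := gamma_lt1.
(* Inserting [a_le] into [1 - 5/3 gamma] times [leB] bounds the right side by [(1 - 5/3 gamma) slack
   + 2/3 gamma slack = (1 - gamma) slack]. *)
rewrite -(ler_pM2l (_ : 0 < 1 - gamma)); last by rewrite subr_gt0.
have c_ge0 : 0 <= 1 - 5 / 3 * gamma by lra.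
have := ler_wpM2l c_ge0 leB; nra.
Qed.

End Potential.

(** * Capping and draw probabilities within one round *)

Section Round.
Context {R : realType}.
Variables (N K : nat) (gamma v : R) (w : 'I_N -> R).
Hypotheses (K_gt0 : (0 < K)%N) (gamma_ge0 : 0 <= gamma) (gamma_lt1 : gamma < 1).
Hypothesis w_gt0 : forall i, 0 < w i.
Hypothesis v_spec : capping K gamma w -> cap_spec K gamma w v.

Lemma capped_set_v_gt0 i : i \in capped_set K gamma w v -> 0 < v.
Proof.
rewrite /capped_set; case: ifP => [/v_spec[]//|_]; by rewrite inE.
Qed.

Lemma capped_weight_gt0 i : 0 < capped_weight K gamma w v i.
Proof. by rewrite /capped_weight; case: ifP => // /capped_set_v_gt0. Qed.

Lemma capped_weight_le i : capped_weight K gamma w v i <= w i.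
Proof.
rewrite /capped_weight; case: ifP => //; rewrite /capped_set.
by case: ifP => _; rewrite inE.
Qed.

Lemma draw_proba_ge i : K%:R * gamma / N%:R <= draw_proba K gamma w v i.
Proof.
rewrite -mulrA ler_pM2l ?ltr0n // lerDr mulr_ge0 ?subr_ge0 ?(ltW gamma_lt1) //.
rewrite divr_ge0 ?(ltW (capped_weight_gt0 _)) // sumr_ge0 // => j _.
exact: ltW (capped_weight_gt0 j).
Qed.

(** The equation defining the cap makes the normalized capped weight contribute [1 / K - gamma / N],
    and exploration adds back [gamma / N]. *)
Lemma draw_proba_capped i :
  i \in capped_set K gamma w v -> draw_proba K gamma w v i = 1.
Proof.
move=> iS; rewrite /draw_proba {1}/capped_weight iS.
have : capping K gamma w.
  by move: iS; rewrite /capped_set; case: ifP => //; rewrite inE.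
move=> cap; have [v_gt0 vE] := v_spec cap.
have -> : \sum_j capped_weight K gamma w v j =
    \sum_j (v * (v <= w j)%R%:R + w j * (w j < v)%R%:R).
  apply: eq_bigr => j _; rewrite /capped_weight /capped_set cap inE.
  by case: leP => _; rewrite !(mulr1, mulr0, addr0, add0r).
rewrite mulrA [(1 - gamma) * v]mulrC -vE subrK divff // pnatr_eq0.
by rewrite -lt0n.
Qed.

(** Capping keeps the weight of an uncapped arm and only lowers the normalizing sum; the exploration
    term is nonnegative. *)
Lemma weight_le_draw_proba i : i \notin capped_set K gamma w v ->
  K%:R * (1 - gamma) * w i <= draw_proba K gamma w v i * \sum_j w j.
Proof.
move=> iS; rewrite /draw_proba {1}/capped_weight (negbTE iS).
set W := \sum_j capped_weight K gamma w v j.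
have W_gt0 : 0 < W.
  rewrite /W (bigD1 i) //= ltr_pwDl ?capped_weight_gt0 // sumr_ge0 // => j _.
  exact: ltW (capped_weight_gt0 j).
have W_le : W <= \sum_j w j by apply: ler_sum => j _; exact: capped_weight_le.
have g_ge0 : 0 <= 1 - gamma by rewrite subr_ge0 ltW.
apply: le_trans (_ : K%:R * ((1 - gamma) * (w i / W) + gamma / N%:R) * W <= _).
  rewrite -[leRHS]mulrA -[leLHS]mulrA ler_pM2l ?ltr0n // [leRHS]mulrDl.
  rewrite mulrA divfK ?gt_eqF // lerDl.
  by rewrite mulr_ge0 ?divr_ge0 // ltW.
apply: ler_wpM2l => //; rewrite mulr_ge0 // addr_ge0 ?divr_ge0 //.
by rewrite mulr_ge0 // divr_ge0 // ltW.
Qed.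

End Round.

(** * Finite sums over histories *)

(** The latest draw is the innermost sum, so a one-step conditional inequality is an inequality
    between summands. *)
Fixpoint history_sum {R : realType} {N : nat} (t : nat) (F : history N -> R) : R :=
  if t is u.+1 then history_sum u (fun h => \sum_(A : {set 'I_N}) F (A :: h))
  else F [::].

Lemma ler_history_sum {R : realType} {N : nat} (t : nat) (F G : history N -> R) :
  (forall h, size h = t -> F h <= G h) -> history_sum t F <= history_sum t G.
Proof.
elim: t F G => [|t IH] F G FG /=; first exact: FG.
by apply: IH => h ht; apply: ler_sum => A _; apply: FG; rewrite /= ht.
Qed.

Lemma eq_history_sum {R : realType} {N : nat} (t : nat) (F G : history N -> R) :
  (forall h, size h = t -> F h = G h) -> history_sum t F = history_sum t G.
Proof.
by move=> FG; apply/le_anti/andP; split; apply: ler_history_sum => h /FG ->.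
Qed.

Lemma history_sum_scale {R : realType} {N : nat} (t : nat) (c : R)
    (F : history N -> R) :
  history_sum t (fun h => c * F h) = c * history_sum t F.
Proof.
elim: t F => [//|t IH] F /=; rewrite -IH.
by apply: eq_history_sum => h _; rewrite mulr_sumr.
Qed.

Lemma history_sum_sum {R : realType} {N : nat} (t : nat) (I : finType)
    (F : I -> history N -> R) :
  history_sum t (fun h => \sum_i F i h) = \sum_i history_sum t (F i).
Proof.
elim: t F => [//|t IH] F /=; rewrite -IH.
by apply: eq_history_sum => h _; rewrite exchange_big.
Qed.

Lemma probability_fibers {R : realType} (d : measure_display)
    (Omega : measurableType d) (P : probability Omega R) (I : finType)
    (f : Omega -> I) (E : set Omega) :
  (forall i, measurable [set omega | f omega = i]) -> measurable E ->
  fine (P E) = \sum_i fine (P (E `&` [set omega | f omega = i])).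
Proof.
move=> mf mE.
have mEf i : measurable (E `&` [set omega | f omega = i]) by exact: measurableI.
have -> : P E = P (\bigcup_(i in [set` index_enum I])
    (E `&` [set omega | f omega = i])).
  congr (P _); apply/seteqP; split => [omega Eo|omega [i _ []]//].
  by exists (f omega) => //=; exact: mem_index_enum.
rewrite measure_fin_bigcup //; last first.
  by move=> i j _ _ [omega [[_ /= <-] [_ /= <-]]].
by rewrite -fsbig_seq ?index_enum_uniq // sum_fine // => i _; exact: fin_num_measure.
Qed.

Lemma size_past {Omega : Type} {N : nat} (a : nat -> Omega -> {set 'I_N}) t omega :
  size (past a t omega) = t.
Proof. by elim: t => //= t ->. Qed.

Lemma past_inj {Omega : Type} {N : nat} (a : nat -> Omega -> {set 'I_N})
    t u (omega1 omega2 : Omega) : (u < t)%N ->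
  past a t omega1 = past a t omega2 -> a u omega1 = a u omega2.
Proof.
elim: t => //= t IH; rewrite ltnS leq_eqVlt => /predU1P[->|ut] [at_eq past_eq] //.
exact: IH.
Qed.

Lemma past_le {Omega : Type} {N : nat} (a : nat -> Omega -> {set 'I_N})
    t u (omega1 omega2 : Omega) : (u <= t)%N ->
  past a t omega1 = past a t omega2 -> past a u omega1 = past a u omega2.
Proof.
elim: t => [|t IH]; first by rewrite leqn0 => /eqP ->.
by rewrite leq_eqVlt ltnS => /predU1P[->//|ut] [_ /(IH ut)].
Qed.

(** * Law of the draws and concentration of the reward estimates *)

Section Run.
Context {R : realType}.
Variables (N K T : nat) (gamma alpha : R) (r : nat -> 'I_N -> R).
Context {d : measure_display} {Omega : measurableType d}.
Variables (P : probability Omega R) (a : nat -> Omega -> {set 'I_N}).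
Variable v : history N -> R.
Hypothesis run : exp3pm_run K T gamma alpha r P a v.
Hypotheses (K_gt0 : (0 < K)%N) (gamma_gt0 : 0 < gamma) (gamma_lt1 : gamma < 1).
Hypothesis r01 : forall t i, (t < T)%N -> 0 <= r t i <= 1.

Let W h := weight K T gamma alpha r v h.
Let p h i := history_proba K T gamma alpha r v h i.
Let S h := capped_set K gamma (W h) (v h).
Let q h := fine (P [set omega | past a (size h) omega = h]).

Lemma weight_gt0 h i : 0 < W h i.
Proof.
by elim: h => [|A h IH] /=; rewrite ?expR_gt0 // mulr_gt0 ?expR_gt0.
Qed.

Lemma measurable_past t (Q : history N -> Prop) : (t <= T)%N ->
  measurable [set omega | Q (past a t omega)].
Proof.
elim: t Q => [|t IH] Q tT /=.
  have [Q0|Q0] := pselect (Q [::]).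
    by rewrite (_ : [set _ | _] = setT) //; apply/seteqP; split.
  by rewrite (_ : [set _ | _] = set0) //; apply/seteqP; split.
have -> : [set omega | Q (a t omega :: past a t omega)] =
    \bigcup_(A in [set` index_enum {set 'I_N}])
      ([set omega | a t omega = A] `&` [set omega | Q (A :: past a t omega)]).
  apply/seteqP; split => [omega Qo|omega [A _ [/= <- //]]].
  by exists (a t omega) => //=; exact: mem_index_enum.
apply: fin_bigcup_measurable => // A _; apply: measurableI.
  exact: run_measurable run _ _ tT.
by apply: (IH (fun h => Q (A :: h))); exact: ltnW.
Qed.

Lemma measurable_past_eq t h : (t <= T)%N ->
  measurable [set omega | past a t omega = h].
Proof. by move=> tT; exact: (measurable_past (fun h' => h' = h) tT). Qed.

Lemma fine_probability_ge0 (E : set Omega) : 0 <= fine (P E).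
Proof. exact: fine_ge0. Qed.

Lemma probability_history_sum t (E : set Omega) : (t <= T)%N -> measurable E ->
  fine (P E) =
  history_sum t (fun h => fine (P ([set omega | past a t omega = h] `&` E))).
Proof.
elim: t => [|t IH] tT mE /=.
  by rewrite (_ : [set _ | _] = setT) ?setTI //; apply/seteqP; split.
rewrite IH //; last exact: ltnW.
apply: eq_history_sum => h _.
rewrite (probability_fibers P (f := a t)); last 2 first.
- by move=> A; exact: run_measurable run _ _ tT.
- by apply: measurableI => //; apply: measurable_past_eq; exact: ltnW.
apply: eq_bigr => A _; congr (fine (P _)); apply/seteqP; split => omega /=.
  by move=> [[-> Eo] ->].
by move=> [[-> ->] Eo].
Qed.

Lemma history_mass_nil : q [::] = 1.
Proof.
rewrite /q /= (_ : [set _ | _] = setT) ?probability_setT //.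
by apply/seteqP; split.
Qed.

Lemma history_mass_next h : (size h < T)%N -> q h = \sum_A q (A :: h).
Proof.
move=> hT; rewrite /q (probability_fibers P (f := a (size h))); last 2 first.
- by move=> A; exact: run_measurable run _ _ hT.
- by apply: measurable_past_eq; exact: ltnW.
apply: eq_bigr => A _; congr (fine (P _)); apply/seteqP; split => omega /=.
  by move=> [-> ->].
by move=> [-> ->].
Qed.

Lemma history_mass_marginal h i : (size h < T)%N ->
  \sum_(A : {set 'I_N} | i \in A) q (A :: h) = p h i * q h.
Proof.
move=> hT; have mh : measurable [set omega | past a (size h) omega = h].
  by apply: measurable_past_eq; exact: ltnW.
have -> : p h i * q h = fine (P ([set omega | past a (size h) omega = h] `&`
    [set omega | i \in a (size h) omega])).
  by rewrite (run_marginal run) // fineM // fin_num_measure.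
rewrite (probability_fibers P (f := a (size h))); last 2 first.
- by move=> A; exact: run_measurable run _ _ hT.
- apply: measurableI => //.
  (* The past after this round is nonempty, so the default of [head] is never read. *)
  rewrite (_ : [set _ | _] = [set omega |
    (fun h => i \in head finset.set0 h) (past a (size h).+1 omega)]) //.
  exact: (measurable_past (fun h => i \in head finset.set0 h) hT).
rewrite [LHS]big_mkcond; apply: eq_bigr => A _; case: ifPn => iA.
  congr (fine (P _)); apply/seteqP; split => omega /=.
    by move=> [Ea ->]; rewrite Ea.
  by move=> [[-> _] ->].
rewrite (_ : _ `&` _ = set0) ?measure0 //; apply/seteqP; split => // omega /=.
by move=> [[_ iaA] aA]; rewrite aA (negbTE iA) in iaA.
Qed.

Lemma run_cap_past t omega : (t < T)%N ->
  let h := past a t omega in capping K gamma (W h) -> cap_spec K gamma (W h) (v h).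
Proof. exact: run_cap run _ _. Qed.

Lemma history_realized h : 0 < q h -> exists omega, past a (size h) omega = h.
Proof.
move=> q_gt0; apply: contrapT => none; move: q_gt0; rewrite /q.
rewrite (_ : [set _ | _] = set0) ?measure0 ?ltxx //.
by apply/seteqP; split => // omega /= ho; case: none; exists omega.
Qed.

(** A capped arm has conditional probability 1, so each continuation missing it has mass 0. Such
    draws can occur on a null event, hence the positive mass required of the full history, which
    passes to its prefixes. *)
Lemma capped_set_drawn omega t : 0 < q (past a T omega) -> (t < T)%N ->
  S (past a t omega) \subset a t omega.
Proof.
move=> q_gt0 tT; apply/fintype.subsetP => i iS; apply: contraLR q_gt0 => ia.
set h := past a t omega in iS *.
have hT : (size h < T)%N by rewrite size_past.
have qA : q (a t omega :: h) = 0.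
  have := history_mass_next hT.
  rewrite (bigID (fun A : {set 'I_N} => i \in A)) /= history_mass_marginal //.
  rewrite /p /history_proba draw_proba_capped //; last exact: run_cap_past.
  rewrite mul1r -[LHS]addr0 => /addrI /esym sum0; apply/eqP.
  move: sum0; rewrite (bigD1 (a t omega)) //= => /eqP.
  rewrite paddr_eq0 ?fine_probability_ge0 ?sumr_ge0 //; first by case/andP.
  by move=> A _; exact: fine_probability_ge0.
rewrite -leNgt -qA /q /= size_past size_past; apply: fine_le.
- by rewrite fin_num_measure //; exact: measurable_past_eq.
- by rewrite fin_num_measure //; exact: (@measurable_past_eq t.+1).
apply: le_measure; rewrite ?inE.
- exact: measurable_past_eq.
- exact: (@measurable_past_eq t.+1).
by move=> omega' /(past_le tT).
Qed.

(* Logarithm of the exponential supermartingale bounding the deviation of the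
   reward estimates of arm [i] in the rounds where [i] is not capped. *)
Fixpoint log_deviation (s : R) (h : history N) (i : 'I_N) : R :=
  if h is A :: h' then
    log_deviation s h' i + (i \notin S h')%:R * (s *
      (r (size h') i - r (size h') i / p h' i * (i \in A)%:R - s / p h' i))
  else 0.

Lemma log_deviation_past s t omega i :
  log_deviation s (past a t omega) i =
  \sum_(u < t) (i \notin S (past a u omega))%:R * (s *
    (r u i - r u i / p (past a u omega) i * (i \in a u omega)%:R
      - s / p (past a u omega) i)).
Proof.
elim: t => [|t IH]; first by rewrite big_ord0.
by rewrite big_ord_recr /= IH size_past.
Qed.

(** Given [h], the exponent depends on [A] only through [i \in A]. Grouping the continuations by
    that bit leaves [importance_weighted_mgf_le1], or an equality when [i] is capped. *)
Lemma exp_deviation_step s h i : 0 <= s <= 1 / 2 -> (size h < T)%N ->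
  \sum_A q (A :: h) * expR (log_deviation s (A :: h) i) <=
  q h * expR (log_deviation s h i).
Proof.
move=> s_bd hT; have qA_ge0 A : 0 <= q (A :: h) by exact: fine_probability_ge0.
have [q_gt0|] := ltP 0 (q h); last first.
  move=> q_le0; have q0 : q h = 0.
    by apply/le_anti; rewrite q_le0 fine_probability_ge0.
  rewrite q0 mul0r big1 // => A _; apply/eqP; rewrite mulf_eq0; apply/orP; left.
  move/eqP: q0; rewrite history_mass_next // psumr_eq0 // => /allP.
  by apply; exact: mem_index_enum.
set x := r (size h) i; set D := log_deviation s h i.
pose Y (b : bool) : R := (i \notin S h)%:R * (s * (x - x / p h i * b%:R - s / p h i)).
have -> : \sum_A q (A :: h) * expR (log_deviation s (A :: h) i) =
    expR D * \sum_A q (A :: h) * expR (Y (i \in A)).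
  by rewrite mulr_sumr; apply: eq_bigr => A _; rewrite /= expRD mulrCA.
rewrite mulrC ler_pM2r ?expR_gt0 //.
have [iS|iS] := boolP (i \in S h).
  under eq_bigr do rewrite /Y iS mul0r expR0 mulr1.
  by rewrite -history_mass_next.
(* The cap equation is granted only along realized histories, so positivity of [p h i] needs an
   outcome; null histories were treated apart. *)
have [omega hE] := history_realized q_gt0.
have p_gt0 : 0 < p h i.
  have p_ge : K%:R * gamma / N%:R <= p h i.
    apply: draw_proba_ge => //; first exact: weight_gt0.
    by rewrite -hE; apply: run_cap_past; rewrite -hE size_past in hT.
  apply: lt_le_trans p_ge.
  by rewrite divr_gt0 ?mulr_gt0 ?ltr0n // (leq_ltn_trans _ (ltn_ord i)).
have drawn := history_mass_marginal i hT.
have undrawn : \sum_(A : {set 'I_N} | i \notin A) q (A :: h) = (1 - p h i) * q h.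
  have := history_mass_next hT.
  by rewrite (bigID (fun A : {set 'I_N} => i \in A)) /= drawn; lra.
(* The run itself forces this: the sets avoiding [i] have nonnegative total mass. *)
have p_le1 : p h i <= 1.
  have : 0 <= (1 - p h i) * q h by rewrite -undrawn sumr_ge0.
  by rewrite pmulr_lge0 // subr_ge0.
rewrite (bigID (fun A : {set 'I_N} => i \in A)) /=.
rewrite (eq_bigr (fun A => q (A :: h) * expR (Y true))); last by move=> A ->.
rewrite [X in _ + X <= _](eq_bigr (fun A => q (A :: h) * expR (Y false)));
  last by move=> A /negbTE ->.
rewrite -!mulr_suml drawn undrawn.
have := importance_weighted_mgf_le1 p_gt0 p_le1 (r01 i hT) s_bd.
rewrite /Y iS !mul1r mulr1 mulr0 subr0 -/x => /(ler_wpM2l (ltW q_gt0)).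
by lra.
Qed.

Lemma exp_deviation_le1 s t i : 0 <= s <= 1 / 2 -> (t <= T)%N ->
  history_sum t (fun h => q h * expR (log_deviation s h i)) <= 1.
Proof.
move=> s_bd; elim: t => [|t IH] tT /=.
  by rewrite history_mass_nil expR0 mulr1.
apply: le_trans (IH (ltnW tT)); apply: ler_history_sum => h ht.
by apply: exp_deviation_step; rewrite ?ht.
Qed.

(** Markov's inequality history by history: if a history of positive mass meets the complement of
    [E], some arm has deviation above [c], and its term [expR (- c) * (q h * expR _)] alone exceeds
    [q h]. *)
Lemma probability_ge_of_deviation s c (E : set Omega) :
  0 <= s <= 1 / 2 -> measurable E ->
  (forall omega, (forall i, log_deviation s (past a T omega) i <= c) ->
     (forall t, (t < T)%N -> S (past a t omega) \subset a t omega) -> E omega) ->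
  ((1 - N%:R * expR (- c))%:E <= P E)%E.
Proof.
move=> s_bd mE EP.
have mCE : measurable (~` E) by exact: measurableC.
rewrite -[E]setCK probability_setC // -[P (~` E)]fineK ?fin_num_measure //.
rewrite -EFinB lee_fin lerD2l lerN2 (probability_history_sum (leqnn T)) //.
apply: le_trans (_ : history_sum T (fun h => \sum_i expR (- c) *
    (q h * expR (log_deviation s h i))) <= _); last first.
  rewrite history_sum_sum.
  apply: le_trans (_ : \sum_(i < N) expR (- c) <= _); last first.
    by rewrite sumr_const card_ord mulr_natl.
  apply: ler_sum => i _; rewrite history_sum_scale ler_piMr ?expR_ge0 //.
  exact: exp_deviation_le1.
apply: ler_history_sum => h hT.
have term_ge0 i : 0 <= expR (- c) * (q h * expR (log_deviation s h i)).
  by rewrite !mulr_ge0 ?expR_ge0 // fine_probability_ge0.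
have le_q : fine (P ([set omega | past a T omega = h] `&` ~` E)) <= q h.
  rewrite /q hT; apply: fine_le; rewrite ?fin_num_measure //.
  - by apply: measurableI => //; exact: measurable_past_eq.
  - exact: measurable_past_eq.
  - by apply: measureIl => //; exact: measurable_past_eq.
have [q_gt0|q_le0] := ltP 0 (q h); last first.
  by apply: le_trans le_q _; apply: le_trans q_le0 _; exact: sumr_ge0.
have [[omega [/= hE notE]]|none] :=
    pselect (exists omega, ([set omega | past a T omega = h] `&` ~` E) omega);
    last first.
  rewrite (_ : _ `&` _ = set0) ?measure0 ?sumr_ge0 //.
  by apply/seteqP; split => // omega Eo; case: none; exists omega.
have [i c_lt] : exists i, c < log_deviation s h i.
  apply: contrapT => none; apply: notE; apply: EP => [i|t tT].
    by rewrite hE leNgt; apply/negP => c_lt; apply: none; exists i.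
  by apply: capped_set_drawn tT; rewrite hE.
apply: le_trans le_q _; rewrite (bigD1 i) //= -[leLHS]addr0 lerD ?sumr_ge0 //.
by rewrite mulrCA -expRD ler_peMr ?(ltW q_gt0) // -expR0 ler_expR; lra.
Qed.

End Run.

(** * Deterministic bounds on the regret *)

Section RegretBound.
Context {R : realType}.
Variables (N K T : nat) (r : nat -> 'I_N -> R).
Hypothesis r01 : forall t i, (t < T)%N -> 0 <= r t i <= 1.

Lemma total_reward_le (B : {set 'I_N}) :
  \sum_(t < T) \sum_(i in B) r t i <= #|B|%:R * T%:R.
Proof.
apply: le_trans (_ : \sum_(t < T) #|B|%:R <= _); last first.
  by rewrite sumr_const card_ord mulr_natr.
apply: ler_sum => t _; apply: le_trans (_ : \sum_(i in B) 1 <= _); last first.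
  by rewrite sumr_const.
by apply: ler_sum => i _; have /andP[] := r01 i (ltn_ord t).
Qed.

Lemma gain_ge0 {Omega : Type} (a : nat -> Omega -> {set 'I_N}) omega :
  0 <= gain T r a omega.
Proof.
apply: sumr_ge0 => t _; apply: sumr_ge0 => i _.
by have /andP[] := r01 i (ltn_ord t).
Qed.

Lemma regret_le {Omega : Type} (a : nat -> Omega -> {set 'I_N}) omega (b : R) :
  0 <= b ->
  (forall B : {set 'I_N}, #|B| = K ->
    \sum_(t < T) \sum_(i in B) r t i <= gain T r a omega + b) ->
  regret K T r a omega <= b.
Proof.
move=> b_ge0 le_b; rewrite lerBlDl; apply: bigmax_le.
  by rewrite addr_ge0 ?gain_ge0.
by move=> B /eqP; exact: le_b.
Qed.

Lemma regret_le_plays {Omega : Type} (a : nat -> Omega -> {set 'I_N}) omega :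
  regret K T r a omega <= K%:R * T%:R.
Proof.
apply: regret_le => [|B <-]; first exact: mulr_ge0.
by apply: le_trans (total_reward_le B) _; rewrite lerDr gain_ge0.
Qed.

Lemma regret_all_arms {Omega : Type} (a : nat -> Omega -> {set 'I_N}) omega :
  K = N -> (forall t, (t < T)%N -> #|a t omega| = K) ->
  regret K T r a omega <= 0.
Proof.
move=> KN card_a; apply: regret_le => // B BK; rewrite addr0.
apply: ler_sum => t _; rewrite le_eqVlt; apply/orP; left; apply/eqP.
have full (C : {set 'I_N}) : #|C| = K -> C = [set: 'I_N]%SET.
  by move=> CK; apply/eqP; rewrite eqEcard finset.subsetT cardsT card_ord CK KN /=.
by rewrite (full B) // (full (a t omega)) // card_a.
Qed.

End RegretBound.

(** * Regret inequality on the event of small deviations *)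

Section HighProbability.
Context {R : realType}.
Variables (N K T : nat) (gamma alpha : R) (r : nat -> 'I_N -> R).
Context {d : measure_display} {Omega : measurableType d}.
Variables (P : probability Omega R) (a : nat -> Omega -> {set 'I_N}).
Variable v : history N -> R.
Hypothesis run : exp3pm_run K T gamma alpha r P a v.
Hypotheses (K_gt0 : (0 < K)%N) (K_le : (K <= N)%N).
Hypotheses (gamma_gt0 : 0 < gamma) (gamma_lt : gamma < 3 / 5).
Hypothesis r01 : forall t i, (t < T)%N -> 0 <= r t i <= 1.

Let s : R := alpha / Num.sqrt (N%:R * T%:R).

Hypotheses (s_gt0 : 0 < s) (s_le : s <= 1 / 2).

(** The log-deviation of arm [i] is [s] times its total reward minus its upper confidence estimate,
    capped rounds cancelling. Each of the [K] arms of [B] thus loses at most [c / s], and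
    [sum_ucb_le] applies. *)
Lemma total_reward_le_of_deviation omega c (B : {set 'I_N}) :
  (forall i, log_deviation K T gamma alpha r v s (past a T omega) i <= c) ->
  (forall t, (t < T)%N ->
     capped_set K gamma (weight K T gamma alpha r v (past a t omega))
       (v (past a t omega)) \subset a t omega) ->
  #|B| = K ->
  (1 - 5 / 3 * gamma) * (\sum_(t < T) \sum_(i in B) r t i - K%:R * (c / s)) <=
  3 * N%:R / gamma * ln (N%:R / K%:R) + gain T r a omega
  + T%:R * N%:R * s + 2 / 3 * (T%:R * N%:R) * s ^+ 2.
Proof.
move=> dev_le drawn BK.
have gamma_lt1 : gamma < 1 by have := gamma_lt; lra.
pose h t := past a t omega; pose W t := weight K T gamma alpha r v (h t).
pose p t := draw_proba K gamma (W t) (v (h t)).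
pose S t := capped_set K gamma (W t) (v (h t)).
have W_gt0 t i : 0 < W t i by exact: weight_gt0.
have cap t : (t < T)%N -> capping K gamma (W t) -> cap_spec K gamma (W t) (v (h t)).
  exact: run_cap run _ _.
have := sum_ucb_le (S := S) (A := fun t => a t omega) (p := p) (w := W)
  (x := r) (T := T) (s := s) (w0 := init_weight N K T gamma alpha)
  K_gt0 K_le gamma_gt0 gamma_lt1 (ltW s_gt0) s_le (expR_gt0 _) r01.
have p_ge t i : (t < T)%N -> K%:R * gamma / N%:R <= p t i.
  by move=> tT; apply: draw_proba_ge => //; exact: cap.
have W_next t i : (t < T)%N -> W t.+1 i = W t i *
    expR (gamma * K%:R / (3 * N%:R) * ((i \notin S t)%:R *
      (r t i / p t i * (i \in a t omega)%:R + s / p t i))).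
  move=> _; rewrite {1}/W /= /next_weight size_past -/(W t) -/(S t).
  rewrite /reward_estimate -/(p t i) /s [(p t i * _)^-1]invfM; congr (_ * expR _).
  by ring.
have W_le t i : (t < T)%N -> i \notin S t ->
    K%:R * (1 - gamma) * W t i <= p t i * \sum_j W t j.
  by move=> tT; apply: weight_le_draw_proba => //; [exact: ltW | exact: cap].
move=> /(_ p_ge (fun=> erefl) W_next W_le drawn B BK gamma_lt) ucb_le.
apply: le_trans ucb_le; apply: ler_wpM2l; first by have := gamma_lt; lra.
rewrite exchange_big /= lerBlDr.
have -> : K%:R * (c / s) = \sum_(i in B) c / s.
  by rewrite sumr_const BK mulr_natl.
rewrite -big_split; apply: ler_sum => i _ /=.
rewrite -lerBlDl -sumrB ler_pdivlMr //.
apply: le_trans (dev_le i); rewrite log_deviation_past mulr_suml.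
apply: ler_sum => t _; rewrite -/(h t) /history_proba -/(W t) -/(S t) -/(p t i).
by case: (i \in S t) => /=; lra.
Qed.

End HighProbability.

(** * Tuning of the parameters *)

Lemma probability_top {R : realType} {d : measure_display}
    {Omega : measurableType d} (P : probability Omega R) (E : set Omega)
    (delta : R) : 0 < delta -> (forall omega, E omega) ->
  ((1 - delta)%:E <= P E)%E.
Proof.
move=> delta_gt0 Eall; rewrite (_ : E = setT) ?probability_setT.
  by rewrite lee_fin; lra.
by apply/seteqP; split.
Qed.

Theorem theorem4 (R : realType) (N K T : nat) (hK1 : (1 <= K)%N)
    (hKN : (K <= N)%N) (hT : (1 <= T)%N) (delta : R) (hdelta0 : 0 < delta)
    (hdelta1 : delta < 1) (r : nat -> 'I_N -> R)
    (hr : forall (t : nat) (i : 'I_N), (t < T)%N -> 0 <= r t i <= 1)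
    (d : measure_display) (Omega : measurableType d) (P : probability Omega R)
    (a : nat -> Omega -> {set 'I_N}) (v : history N -> R)
    (hrun : exp3pm_run K T (gamma_param N K T) (alpha_param N K T delta) r
              P a v) :
  ((1 - delta)%:E <=
   P [set omega | (regret K T r a omega <=
        2 * Num.sqrt 5 * Num.sqrt (N%:R * K%:R * T%:R * ln (N%:R / K%:R))
        + 8 * ((N%:R - K%:R) / (N%:R - 1)) * ln (N%:R * T%:R / delta)
        + 2 * (1 + K%:R ^+ 2) *
            Num.sqrt (N%:R * T%:R * ((N%:R - K%:R) / (N%:R - 1))
                      * ln (N%:R * T%:R / delta)))%R])%E.
Proof.
have N_gt0 : (0 < N)%N := leq_trans hK1 hKN.
have n_gt0 : 0 < N%:R :> R by rewrite ltr0n.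
have k_gt0 : 0 < K%:R :> R by rewrite ltr0n.
have k_ge1 : 1 <= K%:R :> R by rewrite ler1n.
have n_ge1 : 1 <= N%:R :> R by rewrite ler1n.
have t_gt0 : 0 < T%:R :> R by rewrite ltr0n.
have t_ge1 : 1 <= T%:R :> R by rewrite ler1n.
have nk_ge0 : 0 <= N%:R - K%:R :> R by rewrite subr_ge0 ler_nat.
have n1_ge0 : 0 <= N%:R - 1 :> R by rewrite subr_ge0.
have nt_gt0 : 0 < N%:R * T%:R :> R by rewrite mulr_gt0.
have kt_gt0 : 0 < K%:R * T%:R :> R by rewrite mulr_gt0.
have kt_le_nt : K%:R * T%:R <= N%:R * T%:R :> R by rewrite ler_pM2r // ler_nat.
set ell := ln (N%:R / K%:R); set lam := ln (N%:R * T%:R / delta).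
set rho := (N%:R - K%:R) / (N%:R - 1).
set X := Num.sqrt (N%:R * K%:R * T%:R * ell).
set Z := Num.sqrt (N%:R * T%:R * rho * lam).
have rho_ge0 : 0 <= rho by rewrite divr_ge0.
have lam_gt0 : 0 < lam.
  rewrite ln_gt0 // ltr_pdivlMr // mul1r (lt_le_trans hdelta1) //.
  exact: mulr_ege1.
have L_ge0 : 0 <= rho * lam by rewrite mulr_ge0 // ltW.
have X_ge0 : 0 <= X by exact: sqrtr_ge0.
have Z_ge0 : 0 <= Z by exact: sqrtr_ge0.
have sqrt5_gt0 : 0 < Num.sqrt 5 :> R by rewrite sqrtr_gt0.
have sqrt5_sq : Num.sqrt 5 * Num.sqrt 5 = 5 :> R by rewrite -expr2 sqr_sqrtr.
have sqrt5V : 3 / Num.sqrt 5 = 3 / 5 * Num.sqrt 5 :> R.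
  apply: (mulIf (lt0r_neq0 sqrt5_gt0)); rewrite divfK ?gt_eqF // -[RHS]mulrA sqrt5_sq.
  by field.
set b := 2 * Num.sqrt 5 * X + 8 * rho * lam + 2 * (1 + K%:R ^+ 2) * Z.
have bX_ge0 : 0 <= 2 * Num.sqrt 5 * X by rewrite !mulr_ge0 // ltW.
have bZ_ge : 2 * (2 * Z) <= 2 * (1 + K%:R ^+ 2) * Z.
  rewrite mulrA; apply: ler_wpM2r => //.
  by have : 1 <= K%:R ^+ 2 :> R; [exact: exprn_ege1 | lra].
have b_ge0 : 0 <= b by rewrite /b; lra.
have small_horizon : K%:R * T%:R <= b ->
    ((1 - delta)%:E <= P [set omega | (regret K T r a omega <= b)%R])%E.
  move=> kt_le; apply: probability_top => // omega.
  exact: le_trans (regret_le_plays K hr a omega) kt_le.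
(* This case absorbs [N = 1], so that [rho] is a genuine quotient afterwards. *)
have [KN|K_neqN] := eqVneq K N.
  apply: probability_top => // omega; apply: le_trans b_ge0.
  by apply: regret_all_arms => // t; exact: run_card hrun _ _.
have K_ltN : (K < N)%N by rewrite ltn_neqAle K_neqN.
have n1_gt0 : 0 < N%:R - 1 :> R.
  by rewrite subr_gt0 ltr1n (leq_ltn_trans hK1 K_ltN).
have nk_ge1 : 1 <= N%:R - K%:R :> R by rewrite lerBrDl natr1 ler_nat.
have rho_gt0 : 0 < rho by rewrite divr_gt0 //; lra.
(* [K (N - K) - (N - 1) = (K - 1) (N - K - 1) >= 0]. *)
have k_rho_ge1 : 1 <= K%:R * rho by rewrite mulrA ler_pdivlMr // mul1r; nra.
have ell_gt0 : 0 < ell.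
  by rewrite ln_gt0 // ltr_pdivlMr // mul1r ltr_nat.
pose Y : R := Num.sqrt (N%:R * ell / (K%:R * T%:R)).
have Y_gt0 : 0 < Y by rewrite sqrtr_gt0 divr_gt0 ?mulr_gt0.
have YE : K%:R * T%:R * (Y * Y) = N%:R * ell.
  rewrite -expr2 sqr_sqrtr ?divr_ge0 ?mulr_ge0 ?ltW //.
  by rewrite mulrC divfK ?gt_eqF.
have XE : X = K%:R * T%:R * Y.
  apply/eqP; rewrite -(eqrXn2 (n := 2)) ?mulr_ge0 ?(ltW Y_gt0) //.
  rewrite sqr_sqrtr ?mulr_ge0 ?(ltW ell_gt0) // exprMn [Y ^+ 2]expr2.
  have -> : N%:R * K%:R * T%:R * ell = K%:R * T%:R * (N%:R * ell) by ring.
  by apply/eqP; rewrite -YE; ring.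
set gamma := gamma_param N K T in hrun; set alpha := alpha_param N K T delta in hrun.
pose s : R := alpha / Num.sqrt (N%:R * T%:R).
pose c : R := ln (N%:R / delta).
(* If the minimum is [3 / 5], then [Num.sqrt 5 * Y >= 1], so the first term of [b] already exceeds
   [K T]. *)
have [gamma_big|gamma_small] := leP (3 / 5) (3 / Num.sqrt 5 * Y).
  apply: small_horizon; rewrite /b XE.
  have : 1 <= Num.sqrt 5 * Y.
    rewrite -(@ler_pM2l _ (3 / 5)) ?divr_gt0 // mulr1.
    by move: gamma_big; rewrite sqrt5V; lra.
  move=> /(ler_wpM2l (ltW kt_gt0)).
  have := mulr_ge0 (ler0n R 8) L_ge0.
  by lra.
have gammaE : gamma = 3 / Num.sqrt 5 * Y by rewrite /gamma /gamma_param min_r ?ltW.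
have gamma_gt0 : 0 < gamma by rewrite gammaE mulr_gt0 // divr_gt0.
have gamma_lt : gamma < 3 / 5 by rewrite gammaE.
have alpha_gt0 : 0 < alpha by rewrite mulr_gt0 // sqrtr_gt0 mulr_gt0.
have alpha_sq : alpha ^+ 2 = 4 * (rho * lam).
  rewrite /alpha /alpha_param exprMn sqr_sqrtr; last exact: L_ge0.
  by rewrite -[log_term _ _ _ _]/(rho * lam); ring.
have snt_gt0 : 0 < Num.sqrt (N%:R * T%:R) :> R by rewrite sqrtr_gt0.
have snt_sq : Num.sqrt (N%:R * T%:R) ^+ 2 = N%:R * T%:R :> R.
  by rewrite sqr_sqrtr // ltW.
have s_gt0 : 0 < s by rewrite divr_gt0.
have alphaE : alpha = s * Num.sqrt (N%:R * T%:R) by rewrite divfK ?gt_eqF.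
have ZE : 2 * Z = T%:R * N%:R * s.
  rewrite [T%:R * _]mulrC -snt_sq expr2 -mulrA [_ * s]mulrC -alphaE.
  rewrite /Z (_ : _ * lam = N%:R * T%:R * (rho * lam)); last by ring.
  by rewrite (sqrtrM _ (ltW nt_gt0)); exact: mulrCA.
(* If [s > 1 / 2], then [K T <= N T <= 4 Z <= b]. *)
have [s_le|s_gt] := leP s (1 / 2); last first.
  apply: small_horizon; rewrite /b.
  have : 1 / 2 * (N%:R * T%:R) <= 2 * Z.
    by rewrite ZE; have := ler_wpM2l (ltW nt_gt0) (ltW s_gt); lra.
  by lra.
have c_ge0 : 0 <= c by rewrite ln_ge0 // ler_pdivlMr // mul1r; lra.
(* Since [2 Z s = N T s ^+ 2 = alpha ^+ 2 = 4 rho lam], this follows from [c <= lam] and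
   [K rho >= 1]. *)
have c_le : c / s <= K%:R * (2 * Z).
  rewrite ler_pdivrMr // ZE.
  have -> : K%:R * (T%:R * N%:R * s) * s = K%:R * alpha ^+ 2.
    by rewrite alphaE [(s * _) ^+ 2]exprMn snt_sq; ring.
  have : c <= lam.
    rewrite ler_ln ?posrE ?divr_gt0 // ler_pM2r ?invr_gt0 //.
    by rewrite -[leLHS]mulr1 ler_pM2l.
  rewrite alpha_sq; nra.
(* The level [c] makes the union bound over the arms cost exactly [delta]. *)
have -> : 1 - delta = 1 - N%:R * expR (- c).
  rewrite expRN lnK ?posrE ?divr_gt0 // invf_div mulrCA divff ?mulr1 //.
  by rewrite gt_eqF.
apply: (probability_ge_of_deviation hrun hK1 gamma_gt0 _ hr (s := s)).
- by lra.
- by rewrite ltW.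
(* The regret depends only on the first [T] draws; quantifying over outcomes with the same past
   turns the event into a predicate of the past. *)
- rewrite (_ : [set _ | _] = [set omega | exists omega',
      past a T omega' = past a T omega /\ regret K T r a omega' <= b]).
    exact: (measurable_past hrun (fun h => exists omega',
      past a T omega' = h /\ regret K T r a omega' <= b) (leqnn T)).
  apply/seteqP; split => omega /=; first by exists omega.
  move=> [omega' [past_eq]]; rewrite /regret /gain.
  under eq_bigr do rewrite (past_inj (ltn_ord _) past_eq).
  by [].
move=> omega dev_le drawn; apply: regret_le => // B BK.
have := total_reward_le_of_deviation hrun hK1 hKN gamma_gt0 gamma_lt hr
  s_gt0 s_le dev_le drawn BK.
have := total_reward_le hr B; rewrite BK.
set G := \sum_(t < T) _; set g := gain _ _ _ _ => G_le.
rewrite -/s -/ell -ZE => bound.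
(* The choice of [gamma] balances the exploration loss [5/3 gamma K T] against [3 N / gamma * ell]:
   both equal [Num.sqrt 5 * X]. *)
have gain_term : 5 / 3 * gamma * (K%:R * T%:R) = Num.sqrt 5 * X.
  by rewrite gammaE sqrt5V XE; field.
have hedge_term : 3 * N%:R / gamma * ell = Num.sqrt 5 * X.
  have -> : 3 * N%:R / gamma * ell = 3 * (N%:R * ell) / gamma by ring.
  apply: (mulIf (lt0r_neq0 gamma_gt0)); rewrite divfK ?gt_eqF // -YE.
  have -> : Num.sqrt 5 * X * gamma =
      3 / 5 * (Num.sqrt 5 * Num.sqrt 5) * (K%:R * T%:R) * (Y * Y).
    by rewrite gammaE sqrt5V XE; ring.
  by rewrite sqrt5_sq; field.
have moment_term : 2 / 3 * (T%:R * N%:R) * s ^+ 2 = 8 / 3 * (rho * lam).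
  rewrite (_ : _ * s ^+ 2 = 2 / 3 * alpha ^+ 2); first by rewrite alpha_sq; field.
  by rewrite alphaE [(s * _) ^+ 2]exprMn snt_sq; ring.
move: bound; rewrite hedge_term moment_term => bound.
(* The loss [K (c / s) <= 2 K ^+ 2 Z] joins [T N s = 2 Z] to give [2 (1 + K ^+ 2) Z]; the term
   [8/3 rho lam] is below [8 rho lam]. *)
have e_ge0 := mulr_ge0 (ltW k_gt0) (divr_ge0 c_ge0 (ltW s_gt0)).
have := ler_wpM2l (ltW k_gt0) c_le.
have : 5 / 3 * gamma * G <= Num.sqrt 5 * X.
  by rewrite -gain_term ler_wpM2l // mulr_ge0 // ltW.
have := mulr_ge0 (ltW gamma_gt0) e_ge0.
by rewrite /b; lra.
Qed.
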